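(* Let $(M,\omega)$ be a compact, connected, quantizable symplectic manifold equipped with a Hamiltonian action of the $r$-torus $T$. Then there is a moment map $\Phi:M\to\mathfrak{t}^*$ for the $T$-action such that the vertices of $\Phi$ are integer lattice points.
   Context: Quantizable means $[\omega]$ is an integral cohomology class (no factor of $2\pi$). A moment map satisfies $\iota_{X_A}\omega=-d\langle\Phi,A\rangle$ for $A\in\mathfrak{t}$, where $X_A$ is the vector field on $M$ generated by $A$. A vertex of $\Phi$ is a value $\Phi(x_0)$ at a point $x_0\in M$ fixed by $T$. Identify $\mathfrak{t}\cong\mathbb{R}^r$ so that the kernel of $\exp:\mathfrak{t}\to T$ is $\mathbb{Z}^r$ (i.e. $A\in\mathbb{Z}^r$ generates the closed one-parameter family $e^{2\pi i tA}$, $t\in[0,1]$); integer lattice points of $\mathfrak{t}^*$ are the elements of the dual lattice $\mathbb{Z}^r\subset\mathfrak{t}^*$, i.e. the functionals taking integer values on $\ker\exp$. *)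

(* Defs.v *)
(* MathComp-Analysis, over an arbitrary R : realType. *)
From mathcomp Require Export all_boot all_order all_algebra.
From mathcomp Require Export all_classical all_reals all_analysis.
From mathcomp Require Export complex.
Export numFieldNormedType.Exports.
Export Order.TTheory GRing.Theory Num.Theory.

Set Implicit Arguments.
Unset Strict Implicit.
Unset Printing Implicit Defensive.

Local Open Scope classical_set_scope.
Local Open Scope ring_scope.

(* For U open: f is of class C^k on U. *)
Fixpoint Ck_on (R : realType) (V W : normedModType R) (k : nat)
    (U : set V) (f : V -> W) : Prop :=
  if k is k'.+1 then
    (forall x, U x -> differentiable f x) /\
    (forall v : V, Ck_on k' U (fun x => 'D_v f x))
  else forall x, U x -> {for x, continuous f}.

Definition smooth_on (R : realType) (V W : normedModType R)
    (U : set V) (f : V -> W) : Prop := forall k, Ck_on k U f.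

(* [from] is total, but only its values on the open set [to @` dom] matter. *)
Record chart (R : realType) (X : topologicalType) (n : nat) := Chart {
  dom : set X;
  to : X -> 'rV[R]_n;
  from : 'rV[R]_n -> X;
  dom_open : open dom;
  img_open : open (to @` dom);
  toK : forall x, dom x -> from (to x) = x;
  to_continuous : forall x, dom x -> {for x, continuous to};
  from_continuous : forall y, (to @` dom) y -> {for y, continuous from} }.

Definition img (R : realType) (X : topologicalType) (n : nat)
  (c : chart R X n) : set 'rV[R]_n := to c @` dom c.

(* The atlas need not be maximal; [chart_at] picks a chart around each point. *)
Record manifold (R : realType) (n : nat) := Manifold {
  carrier :> topologicalType;
  carrier_hausdorff : hausdorff_space carrier;
  carrier_second_countable : @second_countable carrier;
  atlas : set (chart R carrier n);
  chart_at : carrier -> chart R carrier n;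
  chart_at_atlas : forall x, atlas (chart_at x);
  chart_at_dom : forall x, dom (chart_at x) x;
  transition_smooth : forall c d, atlas c -> atlas d ->
    smooth_on (to c @` (dom c `&` dom d)) (to d \o from c) }.

Definition smooth_into (R : realType) (n : nat) (M : manifold R n)
    (V : normedModType R) (U : set V) (f : V -> M) : Prop :=
  (forall x, U x -> {for x, continuous f}) /\
  (forall c, atlas c -> smooth_on (U `&` f @^-1` dom c) (to c \o f)).

Definition smooth_fun (R : realType) (n : nat) (M : manifold R n)
    (W : normedModType R) (f : M -> W) : Prop :=
  forall c, atlas c -> smooth_on (img c) (f \o from c).

(* A field of bilinear forms on M is given by its Gram matrix in each chart;
   [form_at w c x u v] is its value at x on the tangent vectors whose
   components in the chart c are u and v. *)
Definition form_field (R : realType) (n : nat) (M : manifold R n) :=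
  chart R M n -> 'rV[R]_n -> 'M[R]_n.

Definition form_at (R : realType) (n : nat) (M : manifold R n)
    (w : form_field M) (c : chart R M n) (x : M) (u v : 'rV[R]_n) : R :=
  (u *m w c (to c x) *m v^T) 0 0.

(* f^* w = w.  For f = id this is the tensor transformation law between the
   representatives of w in two overlapping charts. *)
Definition preserves_form (R : realType) (n : nat) (M : manifold R n)
    (w : form_field M) (f : M -> M) : Prop :=
  forall c d x (u v : 'rV[R]_n), atlas c -> atlas d -> dom c x -> dom d (f x) ->
    let g := to d \o f \o from c in
    form_at w d (f x) ('D_u g (to c x)) ('D_v g (to c x)) = form_at w c x u v.

(* In [closed], the bracket of constant vector fields vanishes, so the cyclic
   sum is dw(u1, u2, u3). *)
Record symplectic_form (R : realType) (n : nat) (M : manifold R n)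
    (w : form_field M) : Prop := SymplecticForm {
  form_smooth : forall c, atlas c -> smooth_on (img c) (w c);
  form_tensorial : preserves_form w id;
  form_alternating : forall c x u, atlas c -> dom c x -> form_at w c x u u = 0;
  form_nondegenerate : forall c x, atlas c -> dom c x ->
    forall u, (forall v, form_at w c x u v = 0) -> u = 0;
  form_closed : forall c y (u1 u2 u3 : 'rV[R]_n), atlas c -> img c y ->
    let w_ (u v z : 'rV[R]_n) : R^o := (u *m w c z *m v^T) 0 0 in
    'D_u1 (w_ u2 u3) y + 'D_u2 (w_ u3 u1) y + 'D_u3 (w_ u1 u2) y = 0 }.

Definition std_simplex (R : realType) (k : nat) : set 'rV[R]_k.+1 :=
  [set t : 'rV[R]_k.+1 | (forall i, 0 <= t 0 i) /\ \sum_i t 0 i = 1].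

Definition face (R : realType) (k : nat) (i : 'I_k.+2) (t : 'rV[R]_k.+1) :
    'rV[R]_k.+2 :=
  \row_j (if unlift i j is Some j' then t 0 j' else 0).

(* A smooth singular k-simplex is carried by a total map that is smooth near
   the standard simplex; maps agreeing on it are the same simplex, and
   [cochain] requires functions on simplices to respect this. *)
Definition smooth_simplex (R : realType) (n : nat) (M : manifold R n) (k : nat)
    (sigma : 'rV[R]_k.+1 -> M) : Prop :=
  exists U : set 'rV[R]_k.+1,
    [/\ open U, @std_simplex R k `<=` U & smooth_into U sigma].

Definition cochain (R : realType) (n : nat) (M : manifold R n) (k : nat)
    (G : Type) (a : ('rV[R]_k.+1 -> M) -> G) : Prop :=
  forall sigma tau, (forall t, std_simplex t -> sigma t = tau t) ->
    a sigma = a tau.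

Definition coboundary (R : realType) (n : nat) (M : manifold R n) (k : nat)
    (G : zmodType) (a : ('rV[R]_k.+1 -> M) -> G) (sigma : 'rV[R]_k.+2 -> M) : G :=
  \sum_(i < k.+2) a (sigma \o face i) *~ (-1) ^+ i.

(* The triangle is parametrized by (s, t) |-> (1 - s - t, s, t). *)
Definition integral_simplex (R : realType) (n : nat) (M : manifold R n)
    (w : form_field M) (sigma : 'rV[R]_3 -> M) : R :=
  let e (i : 'I_3) : 'rV[R]_3 := delta_mx 0 i in
  let e0 := e 0 in let e1 := e 1 in let e2 := e 2 in
  let density (s t : R) : R :=
    let p := (1 - s - t) *: e0 + s *: e1 + t *: e2 in
    let c := chart_at (sigma p) in
    form_at w c (sigma p) ('D_(e1 - e0) (to c \o sigma) p)
                          ('D_(e2 - e0) (to c \o sigma) p) in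
  \int[lebesgue_measure]_(s in `[0, 1])
    \int[lebesgue_measure]_(t in `[0, 1 - s]) density s t.

(* The image of [w] under the de Rham map to H^2(M; R) (smooth singular
   cohomology) lies in the image of H^2(M; Z): the cochain of integrals of w
   differs by a real coboundary from an integer-valued cocycle. *)
Definition integral_class (R : realType) (n : nat) (M : manifold R n)
    (w : form_field M) : Prop :=
  exists (a : ('rV[R]_3 -> M) -> int) (b : ('rV[R]_2 -> M) -> R),
    [/\ cochain a, cochain b,
        (forall sigma, smooth_simplex sigma -> coboundary a sigma = 0) &
        (forall sigma, smooth_simplex sigma ->
           integral_simplex w sigma - (a sigma)%:~R = coboundary b sigma)].

(* The torus U(1)^r inside C^r, with componentwise multiplication. *)
Definition torus (R : realType) (r : nat) : set 'rV[R[i]]_r :=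
  [set z : 'rV[R[i]]_r | forall j, `|z 0 j| = 1].

Definition torus_mul (R : realType) (r : nat) (z z' : 'rV[R[i]]_r) :
    'rV[R[i]]_r := \row_j (z 0 j * z' 0 j).

Definition torus_one (R : realType) (r : nat) : 'rV[R[i]]_r := const_mx 1.

(* exp(A) = e^(2 pi i A), so that ker exp = Z^r. *)
Definition torus_exp (R : realType) (r : nat) (A : 'rV[R]_r) : 'rV[R[i]]_r :=
  \row_j (cos (2 * pi * A 0 j) +i* sin (2 * pi * A 0 j))%C.

(* As torus_exp : R^r -> T is a smooth covering, smoothness of T x M -> M is
   smoothness of its lift to R^r x M. *)
Record torus_action (R : realType) (n r : nat) (M : manifold R n)
    (act : 'rV[R[i]]_r -> M -> M) : Prop := TorusAction {
  act_one : forall x, act (torus_one R r) x = x;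
  act_mul : forall z z' x, torus z -> torus z' ->
    act (torus_mul z z') x = act z (act z' x);
  act_smooth : forall c, atlas c ->
    smooth_into ([set: 'rV[R]_r] `*` img c)
      (fun p : 'rV[R]_r * 'rV[R]_n => act (torus_exp p.1) (from c p.2)) }.

(* Components in the chart c of X_A(x) = d/dt exp(tA).x at t = 0. *)
Definition generated_field (R : realType) (n r : nat) (M : manifold R n)
    (act : 'rV[R[i]]_r -> M -> M) (A : 'rV[R]_r) (c : chart R M n) (x : M) :
    'rV[R]_n :=
  derive1 (fun t : R => to c (act (torus_exp (t *: A)) x)) 0.

(* The dual of t = R^r is identified with R^r through this pairing. *)
Definition pairing (R : realType) (r : nat) (xi A : 'rV[R]_r) : R :=
  \sum_j xi 0 j * A 0 j.

Definition moment_map (R : realType) (n r : nat) (M : manifold R n)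
    (w : form_field M) (act : 'rV[R[i]]_r -> M -> M) (Phi : M -> 'rV[R]_r) :
    Prop :=
  smooth_fun Phi /\
  forall (A : 'rV[R]_r) c x (v : 'rV[R]_n), atlas c -> dom c x ->
    form_at w c x (generated_field act A c x) v =
    - 'D_v (fun y => pairing (Phi (from c y)) A : R^o) (to c x).

Record hamiltonian_action (R : realType) (n r : nat) (M : manifold R n)
    (w : form_field M) (act : 'rV[R[i]]_r -> M -> M) : Prop :=
  HamiltonianAction {
    ham_action : torus_action act;
    ham_symplectic : forall z, torus z -> preserves_form w (act z);
    ham_moment : exists Phi : M -> 'rV[R]_r, moment_map w act Phi }.

Definition fixed_point (R : realType) (n r : nat) (M : manifold R n)
    (act : 'rV[R[i]]_r -> M -> M) (x : M) : Prop :=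
  forall z, torus z -> act z x = x.

Definition vertex (R : realType) (n r : nat) (M : manifold R n)
    (act : 'rV[R[i]]_r -> M -> M) (Phi : M -> 'rV[R]_r) (xi : 'rV[R]_r) : Prop :=
  exists2 x0 : M, fixed_point act x0 & xi = Phi x0.

Definition integer_lattice_point (R : realType) (r : nat) (xi : 'rV[R]_r) :
    Prop :=
  forall A : 'rV[R]_r, torus_exp A = torus_one R r -> pairing xi A \is a Num.int.

(* Main.v *)
From HB Require Import structures.
Require Import Defs.
From mathcomp Require Import ring lra.

(** Fix a moment map [Phi] and a lattice element [A], so that
    [t |-> exp (t A)], [0 <= t <= 1], is a closed one-parameter subgroup, and
    write [Phi_A] for the component of [Phi] along [A].  Through every point
    [x] runs the loop [l_x : t |-> exp (t A) x].  Sweeping a path [g] from [x]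
    to [y] by the circle gives a cylinder with boundary [l_y - l_x], and the
    moment map equation says that its area is [Phi_A y - Phi_A x].  If [omega]
    is integral, the area of the cylinder is, modulo integers, the value on
    its boundary of the real 1-cochain [b] that witnesses integrality; hence
    [Phi_A x - b l_x] modulo integers does not depend on [x].  This is the
    statement that [exp (2 pi i Phi_A)] agrees, up to a constant, with the
    holonomy of a prequantum connection around the orbits.

    At a fixed point the loop is constant, and [b] is integral on constant
    simplices (the constant triangle has area zero).  So the values of [Phi_A]
    at any two fixed points differ by an integer, for every lattice element
    [A], and it is enough to translate [Phi] so that it vanishes at one fixed
    point.

    Since only the class of [Phi_A x - b l_x] modulo integers matters, it
    suffices that it is locally constant: [holonomy_defect_segment] treats the
    end points of a segment inside one chart, and connectedness does the rest
    ([connected_locally_constant_mod_int]), so that no path is ever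
    concatenated or smoothed.  The cylinder over a segment is the image of the
    unit square, cut along its diagonal into two affine triangles.  As [Phi_A]
    is constant on the orbits of [exp (t A)], the pullback of [omega] to the
    square is [h' (s) ds dt], where [h s] is the value of [Phi_A] at the point
    [s] of the segment ([form_on_orbit_map], [integral_swept_simplex]), and
    the two double integrals are computed by the fundamental theorem of
    calculus ([integral_square_of_triangles]). *)

Set Implicit Arguments.
Unset Strict Implicit.
Unset Printing Implicit Defensive.

Local Open Scope classical_set_scope.
Local Open Scope ring_scope.

(** * Calculus in normed modules *)

Section Ck.
Context {R : realType}.
Implicit Types V W : normedModType R.

Lemma near0_differentiable V W (h : V -> W) (x : V) :
  (\forall y \near x, h y = 0) -> differentiable h x.
Proof.
move=> h0; have hx : h x = 0 by exact: nbhs_singleton h0.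
have E : h \o shift x = cst (h x) + \0 +o_ 0 id.
  apply/eqaddoP => e e0; have : \forall y \near (0 : V), h (y + x) = 0.
    by rewrite (near_shift x)/=; apply: filterS h0 => y; rewrite /= sub0r addrNK.
  apply: filterS => y hy; rewrite [X in `|X|](_ : _ = 0).
    by rewrite normr0 mulr_ge0 ?normr_ge0 ?(ltW e0).
  by rewrite -[LHS]/(h (y + x) - (h x + 0)) hy hx addr0 subr0.
have c0 : continuous (\0 : V -> W) by move=> y; exact: cst_continuous.
by apply/diff_locallyP; rewrite (diff_unique c0 E); split.
Qed.

Lemma near_eq_differentiable V W (f g : V -> W) (x : V) :
  (\forall y \near x, f y = g y) -> differentiable f x -> differentiable g x.
Proof.
move=> fg df; rewrite (_ : g = f + (g - f)); last by rewrite addrC subrK.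
apply: differentiableD => //; apply: near0_differentiable.
by apply: filterS fg => y fgy; rewrite !fctE fgy subrr.
Qed.

Lemma Ck_on_congr V W k (U : set V) (f g : V -> W) : open U ->
  (forall x, U x -> f x = g x) -> Ck_on k U f -> Ck_on k U g.
Proof.
move=> oU; elim: k f g => [|k IH] f g fg /=.
  move=> cf x Ux; have nfg : \forall y \near x, f y = g y.
    by apply: filterS (open_nbhs_nbhs (conj oU Ux)) => y /fg.
  rewrite /prop_for /continuous_at -fg//.
  by apply: cvg_trans (cf x Ux); exact: near_eq_cvg.
move=> [df Df]; have nfg x : U x -> \forall y \near x, f y = g y.
  by move=> Ux; apply: filterS (open_nbhs_nbhs (conj oU Ux)) => y /fg.
split.
  by move=> x Ux; apply: near_eq_differentiable (nfg x Ux) (df x Ux).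
move=> v; apply: IH (Df v) => x Ux.
by apply: near_eq_derive; exact: nfg.
Qed.

Lemma Ck_on_cst V W k (U : set V) (a : W) : Ck_on k U (cst a : V -> W).
Proof.
elim: k a => [|k IH] a /=; first by move=> x _; exact: cst_continuous.
split; first by move=> x _; exact: differentiable_cst.
move=> v; rewrite (_ : (fun x => _) = cst 0); first exact: IH.
by apply/funext => x; rewrite derive_cst.
Qed.

Lemma derive_comp V V' W (L : V' -> V) (f : V -> W) (p w : V') :
  differentiable L p -> differentiable f (L p) ->
  'D_w (f \o L) p = 'D_('D_w L p) f (L p).
Proof.
move=> dL df; rewrite !deriveE//; last exact: differentiable_comp.
by rewrite diff_comp.
Qed.

(** The chain rule for [f \o L] involves only first derivatives of [L]; when
    these are constant, as for an affine [L], every directional derivative of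
    [f \o L] is again of the form [g \o L], and induction applies. *)
Lemma Ck_on_comp V V' W k (U : set V) (L : V' -> V) (l : V' -> V) (f : V -> W) :
  open U -> (forall p, is_diff p L l) -> Ck_on k U f ->
  Ck_on k (L @^-1` U) (f \o L).
Proof.
move=> oU dL; have cL : continuous L.
  by move=> p; apply: differentiable_continuous; exact: ex_diff.
have oLU : open (L @^-1` U) by exact: open_comp.
elim: k f => [|k IH] f /=.
  by move=> cf p Up; apply: continuous_comp; [exact: cL | exact: cf].
move=> [df Df]; split.
  move=> p Up; apply: differentiable_comp; last exact: df.
  exact: ex_diff.
move=> w; apply: Ck_on_congr (IH _ (Df (l w))) => //= p Up.
rewrite derive_comp//; last exact: df.
by rewrite (deriveE w (@ex_diff _ _ _ _ _ _ _ (dL p))) diff_val.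
Qed.

Lemma Ck_on_linear_comp V W W' k (U : set V) (l : W -> W') (f : V -> W) :
  open U -> (forall z, is_diff z l l) -> Ck_on k U f -> Ck_on k U (l \o f).
Proof.
move=> oU dl; elim: k f => [|k IH] f /=.
  move=> cf x Ux; apply: continuous_comp; first exact: cf.
  by apply: differentiable_continuous; exact: ex_diff.
move=> [df Df]; split.
  by move=> x Ux; apply: differentiable_comp; [exact: df | exact: ex_diff].
move=> v; apply: Ck_on_congr (IH _ (Df v)) => // x Ux.
have dlx : differentiable l (f x) by exact: ex_diff.
by rewrite [RHS](derive_comp v (df x Ux) dlx) (deriveE _ dlx) diff_val.
Qed.

End Ck.

Section derivatives_along_lines.
Context {R : realType}.
Implicit Types V W : normedModType R.

(** The difference quotients on both sides coincide, so restricting to a line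
    needs no differentiability assumption. *)
Lemma growth_rate_line V W (f : V -> W) (p w : V) (t : R) :
  (fun h : R => h^-1 *: (f (p + (h *: 1 + t) *: w) - f (p + t *: w))) =
  (fun h => h^-1 *: (f (h *: w + (p + t *: w)) - f (p + t *: w))).
Proof. by apply/funext => h; rewrite scalerDl addrCA [_%:A]mulr1. Qed.

Lemma derive_line V W (f : V -> W) (p w : V) (t : R) :
  'D_1 (fun s : R => f (p + s *: w)) t = 'D_w f (p + t *: w).
Proof. by rewrite /derive growth_rate_line. Qed.

Lemma derivable_line V W (f : V -> W) (p w : V) (t : R) :
  derivable f (p + t *: w) w -> derivable (fun s : R => f (p + s *: w)) t 1.
Proof. by rewrite /derivable growth_rate_line. Qed.

Lemma derive_slice V V' W (f : V * V' -> W) (a : V) (z u : V') :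
  'D_(0, u) f (a, z) = 'D_u (fun y => f (a, y)) z.
Proof.
rewrite /derive; set F := (X in lim (nbhs (X @ _))).
set G := (X in _ = lim (nbhs (X @ _))); suff -> : F = G by [].
apply/funext => h; congr (_ *: (f _ - _)).
by rewrite -[LHS]/(h *: 0 + a, h *: u + z) scaler0 add0r.
Qed.

Lemma open_setI_preimage (X Y : topologicalType) (U : set X) (V : set Y)
    (f : X -> Y) : open U -> open V -> (forall x, U x -> {for x, continuous f}) ->
  open (U `&` f @^-1` V).
Proof.
move=> oU oV cf; rewrite openE => x [Ux Vfx]; apply: filterI.
  exact: open_nbhs_nbhs.
exact: cf Ux _ (open_nbhs_nbhs (conj oV Vfx)).
Qed.

End derivatives_along_lines.

(** * Integrals over the two triangles of a square *)

Section triangle_integrals.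
Context {R : realType}.
Notation mu := (@lebesgue_measure R).
Implicit Types f : R -> R.

Lemma eq_Rintegral_itv (f g : R -> R) (a b : R) : {in `[a, b], f =1 g} ->
  \int[mu]_(x in `[a, b]) f x = \int[mu]_(x in `[a, b]) g x.
Proof. by move=> fg; apply: eq_Rintegral => x; rewrite inE => /fg. Qed.

Lemma translation_line f (s : R) :
  (fun t => f (s + t)) = (fun t : R => f (s + t *: (1 : R))).
Proof. by apply/funext => t; rewrite [_%:A]mulr1. Qed.

Lemma derive1_translation f (s t : R) :
  (fun t => f (s + t))^`()%classic t = f^`()%classic (s + t).
Proof. by rewrite !derive1E translation_line derive_line [_%:A]mulr1. Qed.

Lemma Rintegral_derive1 f (a b : R) : a <= b ->
  {in `[a, b], forall x, derivable f x 1} ->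
  {in `[a, b], continuous f^`()%classic} ->
  \int[mu]_(x in `[a, b]) f^`()%classic x = f b - f a.
Proof.
rewrite le_eqVlt => /predU1P[-> _ _|ab df cf].
  by rewrite set_itv1 Rintegral_set1 subrr.
have cts x : x \in `[a, b] -> {for x, continuous f}.
  by move=> /df/derivable1_diffP/differentiable_continuous.
rewrite /Rintegral; suff -> : (\int[mu]_(x in `[a, b]) (f^`()%classic x)%:E =
  (f b)%:E - (f a)%:E)%E by [].
apply: (continuous_FTC2 ab); last by [].
- by apply: continuous_in_subspaceT => x; rewrite inE => /cf.
- split.
  + by move=> x /subset_itv_oo_cc/df.
  + by apply: cvg_at_right_filter; apply: cts; rewrite in_itv/= lexx ltW.
  + by apply: cvg_at_left_filter; apply: cts; rewrite in_itv/= lexx ltW.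
Qed.

(** The inner integrals are [f 1 - f s] on one triangle and
    [f 0 - f (1 - s)] on the other, and [s |-> 1 - s] identifies the integrals
    of [f] that remain. *)
Lemma integral_square_of_triangles f :
  {in `[0, 1], forall x, derivable f x 1} ->
  {in `[0, 1], continuous f^`()%classic} ->
  \int[mu]_(s in `[0, 1]) \int[mu]_(t in `[0, 1 - s]) f^`()%classic (s + t) -
  \int[mu]_(s in `[0, 1]) \int[mu]_(t in `[0, 1 - s]) - f^`()%classic t = f 1 - f 0.
Proof.
move=> df cf.
have cts x : x \in `[0, 1] -> {for x, continuous f}.
  by move=> /df/derivable1_diffP/differentiable_continuous.
have wcts : {within `[0, 1], continuous f}.
  by apply: continuous_in_subspaceT => x; rewrite inE => /cts.
have E1 s : s \in `[0, 1] ->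
    \int[mu]_(t in `[0, 1 - s]) f^`()%classic (s + t) = f 1 - f s.
  rewrite in_itv/= => /andP[s0 s1].
  have sub t : t \in `[0, 1 - s] -> s + t \in `[0, 1].
    by rewrite !in_itv/= => /andP[t0 t1]; apply/andP; split; lra.
  rewrite (@eq_Rintegral_itv _ (fun t => (fun t => f (s + t))^`()%classic t)); last first.
    by move=> t _; rewrite derive1_translation.
  rewrite (@Rintegral_derive1 (fun t => f (s + t))); last 3 first.
  - by rewrite subr_ge0.
  - move=> t /sub/df; rewrite translation_line => dft.
    by apply: derivable_line; rewrite [_%:A]mulr1.
  - move=> t /sub/cf ct; rewrite (_ : _^`()%classic = fun t => f^`()%classic (s + t)).
      by apply: continuous_comp ct; apply: continuousD; [exact: cst_continuous|].
    by apply/funext => u; exact: derive1_translation.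
  by rewrite (addrC s (1 - s)) subrK addr0.
have E2 s : s \in `[0, 1] ->
    \int[mu]_(t in `[0, 1 - s]) - f^`()%classic t = f 0 - f (1 - s).
  rewrite in_itv/= => /andP[s0 s1].
  have sub t : t \in `[0, 1 - s] -> t \in `[0, 1].
    by rewrite !in_itv/= => /andP[t0 t1]; apply/andP; split; lra.
  rewrite (@eq_Rintegral_itv _ (fun t => -1 * f^`()%classic t)); last first.
    by move=> t _; rewrite mulN1r.
  rewrite (@RintegralZl _ _ _ mu); first last.
  - apply: continuous_compact_integrable; first exact: segment_compact.
    by apply: continuous_in_subspaceT => t; rewrite inE => /sub/cf.
  - exact: measurable_itv.
  rewrite mulN1r -[RHS]opprB; congr (- _).
  apply: Rintegral_derive1; first by rewrite subr_ge0.
  - by move=> t /sub/df.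
  - by move=> t /sub/cf.
have Rint01_cst (c : R) : \int[mu]_(s in `[0, 1]) cst c s = c.
  transitivity (c * fine (mu (`[0, 1]%classic : set R))).
    by apply: Rintegral_cst; exact: measurable_itv.
  by rewrite lebesgue_measure_itv/= lte_fin ltr01 oppr0 addr0 mulr1.
have icst (c : R) : mu.-integrable `[0, 1] (EFin \o cst c).
  apply: continuous_compact_integrable; first exact: segment_compact.
  by apply: continuous_subspaceT; exact: cst_continuous.
have if1 : mu.-integrable `[0, 1] (EFin \o f).
  by apply: continuous_compact_integrable => //; exact: segment_compact.
have if2 : mu.-integrable `[0, 1] (EFin \o (fun s => f (1 - s))).
  apply: continuous_compact_integrable; first exact: segment_compact.
  apply: continuous_in_subspaceT => x; rewrite inE/= in_itv/= => x01.
  apply: continuous_comp; first by apply: continuousB; [exact: cst_continuous|].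
  by apply: cts; rewrite in_itv/=; lra.
have I3 : \int[mu]_(s in `[0, 1]) f s = \int[mu]_(s in `[0, 1]) f (1 - s).
  rewrite (@Rintegration_by_substitution_onem _ f 1).
  - by rewrite /unstable.onem subrr.
  - by rewrite ler01 lexx.
  - exact: wcts.
have I1 : \int[mu]_(s in `[0, 1]) \int[mu]_(t in `[0, 1 - s]) f^`()%classic (s + t) =
    f 1 - \int[mu]_(s in `[0, 1]) f (1 - s).
  rewrite (eq_Rintegral_itv E1) (@RintegralB _ _ _ mu _ (cst (f 1)) f).
  - by rewrite Rint01_cst; congr (_ - _); exact: I3.
  - exact: measurable_itv.
  - exact: icst.
  - exact: if1.
have I2 : \int[mu]_(s in `[0, 1]) \int[mu]_(t in `[0, 1 - s]) - f^`()%classic t =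
    f 0 - \int[mu]_(s in `[0, 1]) f (1 - s).
  rewrite (eq_Rintegral_itv E2) (@RintegralB _ _ _ mu _ (cst (f 0))).
  - by rewrite Rint01_cst.
  - exact: measurable_itv.
  - exact: icst.
  - exact: if2.
have telescope (a b j : R) : a - j - (b - j) = a - b by ring.
exact: etrans (congr2 (fun a b => a - b) I1 I2) (telescope _ _ _).
Qed.

End triangle_integrals.

(** * The torus and the pairing *)

Section torus_and_pairing.
Context {R : realType} {r : nat}.
Implicit Types A B xi : 'rV[R]_r.

Lemma torus_expT A : torus (torus_exp A).
Proof.
by move=> j; rewrite mxE normc_def/= cos2Dsin2 sqrtr1.
Qed.

Lemma torus_expD A B :
  torus_exp (A + B) = torus_mul (torus_exp A) (torus_exp B).
Proof.
apply/rowP => j; rewrite !mxE mulrDr cosD sinD.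
by apply/eqP; rewrite eq_complex/= eqxx addrC mulrC [X in _ + X]mulrC !eqxx.
Qed.

Lemma torus_exp0 : torus_exp (0 : 'rV[R]_r) = torus_one R r.
Proof. by apply/rowP => j; rewrite !mxE mulr0 cos0 sin0. Qed.

Lemma pairingBl xi xi' A : pairing (xi - xi') A = pairing xi A - pairing xi' A.
Proof. by rewrite /pairing -sumrB; apply: eq_bigr => j _; rewrite !mxE mulrBl. Qed.

Lemma pairingDl xi xi' A : pairing (xi + xi') A = pairing xi A + pairing xi' A.
Proof. by rewrite /pairing -big_split; apply: eq_bigr => j _; rewrite !mxE mulrDl. Qed.

Lemma pairingZl (k : R) xi A : pairing (k *: xi) A = k * pairing xi A.
Proof. by rewrite /pairing mulr_sumr; apply: eq_bigr => j _; rewrite !mxE mulrA. Qed.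

Lemma pairing_delta i A : pairing (delta_mx 0 i) A = A 0 i.
Proof.
rewrite /pairing (bigD1 i)//= big1 ?addr0 ?mxE ?eqxx ?mul1r// => j ji.
by rewrite !mxE (negbTE ji) mul0r.
Qed.

Lemma pairing_is_linear A : linear (fun xi => pairing xi A : R^o).
Proof. by move=> k xi xi'; rewrite pairingDl pairingZl. Qed.

Lemma is_diff_pairing A xi :
  is_diff xi (fun xi => pairing xi A : R^o) (fun xi => pairing xi A : R^o).
Proof.
pose f : {linear 'rV[R]_r -> R^o} := HB.pack (fun xi => pairing xi A : R^o)
  (GRing.isLinear.Build _ _ _ _ _ (pairing_is_linear A)).
have cf : continuous f.
  have -> : (f : _ -> _) = \sum_j (fun xi => xi 0 j * A 0 j).
    by apply/funext => x; rewrite fct_sumE.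
  move=> x; apply: differentiable_continuous; apply: differentiable_sum => j.
  apply: differentiableM; first exact: differentiable_coord.
  exact: differentiable_cst.
by apply: DiffDef; [exact: (linear_differentiable xi cf) | exact: (diff_lin xi cf)].
Qed.

End torus_and_pairing.

(** * The moment map along circle orbits *)

Section form_at_bilinear.
Context {R : realType} {n : nat} {M : manifold R n}.
Variables (w : form_field M) (c : chart R M n) (x : M).
Implicit Types u v : 'rV[R]_n.

Lemma form_atDl u u' v :
  form_at w c x (u + u') v = form_at w c x u v + form_at w c x u' v.
Proof. by rewrite /form_at !mulmxDl mxE. Qed.

Lemma form_atZl (k : R) u v : form_at w c x (k *: u) v = k * form_at w c x u v.
Proof. by rewrite /form_at -!scalemxAl mxE. Qed.

Lemma form_atDr u v v' :
  form_at w c x u (v + v') = form_at w c x u v + form_at w c x u v'.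
Proof. by rewrite /form_at linearD mulmxDr mxE. Qed.

Lemma form_atZr (k : R) u v : form_at w c x u (k *: v) = k * form_at w c x u v.
Proof. by rewrite /form_at linearZ -scalemxAr mxE. Qed.

Lemma alternating_form_at_combination (X S : 'rV[R]_n) (a1 b1 a2 b2 : R) :
  (forall u, form_at w c x u u = 0) ->
  form_at w c x (b1 *: X + a1 *: S) (b2 *: X + a2 *: S) =
  - (a1 * b2 - a2 * b1) * form_at w c x X S.
Proof.
move=> alt.
have anti : form_at w c x S X = - form_at w c x X S.
  have := alt (S + X); rewrite !form_atDl !form_atDr !alt add0r addr0.
  by move/eqP; rewrite addr_eq0 => /eqP.
rewrite !form_atDl !form_atDr !form_atZl !form_atZr !alt anti; ring.
Qed.

End form_at_bilinear.

Section moment_geometry.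
Context {R : realType} {n r : nat} {M : manifold R n}.
Variables (omega : form_field M) (act : 'rV[R[i]]_r -> M -> M).
Hypothesis act_torus : torus_action act.
Hypothesis omega_alternating :
  forall c x u, atlas c -> dom c x -> form_at omega c x u u = 0.
Variable Phi : M -> 'rV[R]_r.
Hypothesis Phi_moment : moment_map omega act Phi.
Variable A : 'rV[R]_r.

Definition moment_component (x : M) : R^o := pairing (Phi x) A.

Lemma moment_component_smooth d : atlas d ->
  smooth_on (img d) (moment_component \o from d).
Proof.
move=> ad k.
apply: (@Ck_on_linear_comp _ _ _ _ _ _ (fun xi => pairing xi A : R^o)).
- exact: img_open.
- exact: is_diff_pairing.
- exact: Phi_moment.1.
Qed.

Lemma moment_component_near (V : normedModType R) (K : V -> M) (d : chart R M n) (p : V) :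
  dom d (K p) -> {for p, continuous K} ->
  \forall q \near p, ((moment_component \o from d) \o (to d \o K)) q =
    (moment_component \o K) q.
Proof.
move=> dp cK.
have near_d : \forall q \near p, dom d (K q).
  by apply: cK; apply: open_nbhs_nbhs; split; [exact: dom_open|].
by apply: filterS near_d => q dq; rewrite /= toK.
Qed.

Lemma moment_component_from_differentiable (d : chart R M n) x : atlas d -> dom d x ->
  differentiable (moment_component \o from d) (to d x).
Proof.
by move=> ad dx; have [+ _] := moment_component_smooth ad 1; apply; exists x.
Qed.

Lemma differentiable_moment_component (V : normedModType R) (K : V -> M)
    (d : chart R M n) (p : V) :
  atlas d -> dom d (K p) -> {for p, continuous K} ->
  differentiable (to d \o K) p -> differentiable (moment_component \o K) p.
Proof.
move=> ad dp cK dK; apply: near_eq_differentiable (moment_component_near dp cK) _.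
by apply: differentiable_comp => //; exact: moment_component_from_differentiable.
Qed.

(** Near [p] the function [Phi_A \o K] factors through the chart [d], so the
    chain rule carries the moment map equation over from charts to arbitrary
    maps into [M]. *)
Lemma derive_moment_component (V : normedModType R) (K : V -> M)
    (d : chart R M n) (p w : V) :
  atlas d -> dom d (K p) -> {for p, continuous K} ->
  differentiable (to d \o K) p ->
  'D_w (moment_component \o K) p =
  - form_at omega d (K p) (generated_field act A d (K p)) ('D_w (to d \o K) p).
Proof.
move=> ad dp cK dK; rewrite Phi_moment.2// opprK.
rewrite -(near_eq_derive _ (moment_component_near dp cK)) derive_comp//.
exact: moment_component_from_differentiable.
Qed.

Variable c : chart R M n.
Hypothesis atlas_c : atlas c.

(** The map whose smoothness [act_smooth] asserts; all simplices below are
    its composites with affine maps. *)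
Definition orbit_map (q : 'rV[R]_r * 'rV[R]_n) : M :=
  act (torus_exp q.1) (from c q.2).

Let box : set ('rV[R]_r * 'rV[R]_n) := [set: 'rV[R]_r] `*` img c.

Lemma box_open : open box.
Proof.
have -> : box = snd @^-1` img c by apply/seteqP; split => [q []|q].
have := @open_comp _ _ (snd : 'rV[R]_r * 'rV[R]_n -> _) (img c).
by apply; [move=> q _; exact: cvg_snd | exact: img_open].
Qed.

Lemma orbit_map_continuous q : img c q.2 -> {for q, continuous orbit_map}.
Proof. by move=> cq; apply: (act_smooth act_torus atlas_c).1. Qed.

Lemma orbit_map_differentiable (d : chart R M n) q : atlas d -> img c q.2 ->
  dom d (orbit_map q) -> differentiable (to d \o orbit_map) q.
Proof.
move=> ad cq dq.
by have [+ _] := (act_smooth act_torus atlas_c).2 _ ad 1; apply.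
Qed.

Lemma orbit_map_exp (t : R) (B : 'rV[R]_r) y :
  act (torus_exp B) (orbit_map (t *: A, y)) = orbit_map (B + t *: A, y).
Proof.
by rewrite /orbit_map/= torus_expD (act_mul act_torus)//; exact: torus_expT.
Qed.

Lemma generated_field_orbit_map (d : chart R M n) (t : R) y :
  generated_field act A d (orbit_map (t *: A, y)) =
  'D_(A, 0) (to d \o orbit_map) (t *: A, y).
Proof.
rewrite /generated_field derive1E.
rewrite (_ : (fun s => _) =
  (fun s => (to d \o orbit_map) ((t *: A, y) + s *: (A, 0)))); last first.
  apply/funext => s; rewrite [LHS]/= orbit_map_exp; congr (to d (orbit_map _)).
  by rewrite -[RHS]/(t *: A + s *: A, y + s *: 0) scaler0 addr0 addrC.
by rewrite derive_line scale0r addr0.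
Qed.

(** The derivative of [Phi_A] along the flow of [A] is
    [omega (X_A, X_A)] up to sign, so it vanishes. *)
Lemma moment_component_orbit_map (t : R) y : img c y ->
  moment_component (orbit_map (t *: A, y)) = moment_component (from c y).
Proof.
move=> cy.
(* The base point is the start of the flow line of [A] through it. *)
pose line (s : R) := (0, y) + s *: (A, 0 : 'rV[R]_n).
have lineE s : line s = (s *: A, y).
  by rewrite -[LHS]/(0 + s *: A, y + s *: 0) scaler0 addr0 add0r.
have -> : from c y = orbit_map (0 *: A, y).
  by rewrite /orbit_map/= scale0r torus_exp0 (act_one act_torus).
rewrite -!lineE.
apply: (@is_derive_0_is_cst _ (fun s => moment_component (orbit_map (line s)))) => s.
have dom_chart := chart_at_dom (orbit_map (line s)).
have atlas_chart := chart_at_atlas (orbit_map (line s)).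
set d := chart_at _ in dom_chart atlas_chart.
have dK : differentiable (to d \o orbit_map) (line s).
  by apply: orbit_map_differentiable => //; rewrite lineE.
have cK : {for line s, continuous orbit_map}.
  by apply: orbit_map_continuous; rewrite lineE.
apply: DeriveDef.
  apply: (@derivable_line _ _ _ (moment_component \o orbit_map) (0, y) (A, 0)).
  apply: diff_derivable.
  exact: (differentiable_moment_component atlas_chart).
rewrite (@derive_line _ _ _ (moment_component \o orbit_map) (0, y) (A, 0)).
rewrite [LHS](derive_moment_component _ atlas_chart)//.
rewrite -/(line s) lineE -generated_field_orbit_map -lineE.
by rewrite omega_alternating// oppr0.
Qed.

Lemma derive_moment_component_orbit_map (t : R) y u : img c y ->
  'D_(0, u) (moment_component \o orbit_map) (t *: A, y) =
  'D_u (moment_component \o from c) y.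
Proof.
move=> cy; rewrite derive_slice; apply: near_eq_derive.
have near_y : nbhs y (img c) by apply: open_nbhs_nbhs; split; [exact: img_open|].
apply: filterS near_y => z cz; exact: moment_component_orbit_map.
Qed.

(** The pullback of [omega] by [(t, s) |-> exp (t A) (y + s v)] is
    [d Phi_A (v) ds dt]: the coefficient is the determinant of the two
    parameter vectors, and [Phi_A] being invariant, the slope can be read on
    the segment itself. *)
Lemma form_on_orbit_map (d : chart R M n) (t : R) y v (a1 b1 a2 b2 : R) :
  atlas d -> img c y -> dom d (orbit_map (t *: A, y)) ->
  form_at omega d (orbit_map (t *: A, y))
    ('D_(b1 *: A, a1 *: v) (to d \o orbit_map) (t *: A, y))
    ('D_(b2 *: A, a2 *: v) (to d \o orbit_map) (t *: A, y)) =
  (a1 * b2 - a2 * b1) * 'D_v (moment_component \o from c) y.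
Proof.
move=> ad cy dy; have dK := @orbit_map_differentiable d (t *: A, y) ad cy dy.
have lin a b : 'D_(b *: A, a *: v) (to d \o orbit_map) (t *: A, y) =
    b *: generated_field act A d (orbit_map (t *: A, y)) +
    a *: 'D_(0, v) (to d \o orbit_map) (t *: A, y).
  rewrite generated_field_orbit_map !deriveE// -!linearZ -linearD.
  congr ('d _ _ _).
  by rewrite -[RHS]/(b *: A + a *: 0, b *: 0 + a *: v) !scaler0 addr0 add0r.
rewrite !lin alternating_form_at_combination; last first.
  by move=> u; exact: omega_alternating.
rewrite -(derive_moment_component_orbit_map t)// (derive_moment_component _ ad)//.
  by rewrite mulNr mulrN.
exact: orbit_map_continuous.
Qed.

Section swept_segment.
Variables y v : 'rV[R]_n.
Hypothesis segment_img : forall s, 0 <= s <= 1 -> img c (y + s *: v).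

Definition height (s : R) : R := moment_component (from c (y + s *: v)).

Lemma height_derive1 s :
  height^`()%classic s = 'D_v (moment_component \o from c) (y + s *: v).
Proof.
by rewrite derive1E (@derive_line _ _ _ (moment_component \o from c)).
Qed.

Lemma height_derivable : {in `[0, 1], forall s, derivable height s 1}.
Proof.
move=> s s01; apply: (@derivable_line _ _ _ (moment_component \o from c)).
apply: diff_derivable.
have [+ _] := moment_component_smooth atlas_c 1; apply.
by apply: segment_img; rewrite in_itv in s01.
Qed.

Lemma height_derive1_continuous : {in `[0, 1], continuous height^`()%classic}.
Proof.
move=> s s01; rewrite (funext height_derive1).
have c_line : {for s, continuous (fun s : R => y + s *: v)}.
  by apply: continuousD; [exact: cst_continuous | exact: scalel_continuous].
have c_slope : {for y + s *: v, continuous ('D_v (moment_component \o from c))}.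
  have [_ +] := moment_component_smooth atlas_c 1; move=> /(_ v); apply.
  by apply: segment_img; rewrite in_itv in s01.
exact: (continuous_comp c_line c_slope).
Qed.

(** The affine map that sends the [i]-th vertex of the simplex to the point
    of the [(s, t)]-plane with [s = a 0 i] and [t = b 0 i]: barycentric
    coordinates [p] are averaged by pairing them with the vertex values. *)
Definition swept_param k (a b p : 'rV[R]_k) : 'rV[R]_r * 'rV[R]_n :=
  (pairing p b *: A, y + pairing p a *: v).

Definition swept_simplex k (a b p : 'rV[R]_k) : M :=
  orbit_map (swept_param a b p).

Lemma is_diff_swept_param k (a b p : 'rV[R]_k) :
  is_diff p (swept_param a b) (fun w => (pairing w b *: A, pairing w a *: v)).
Proof.
have scal (e : 'rV[R]_k) (W : normedModType R) (u : W) :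
    is_diff p (fun p => pairing p e *: u) (fun w => pairing w e *: u).
  have dp : differentiable (fun p => pairing p e : R^o) p.
    exact: (@ex_diff _ _ _ _ _ _ _ (is_diff_pairing e p)).
  apply: DiffDef; first exact: differentiableZl.
  rewrite diffZl//; apply/funext => w.
  by rewrite (@diff_val _ _ _ _ _ _ _ (is_diff_pairing e p)).
apply: is_diff_pair => //.
have := is_diffD (is_diff_cst y p) (scal a _ v).
by rewrite add0r.
Qed.

Lemma pairing_std_simplex k (a p : 'rV[R]_k.+1) :
  (forall i, 0 <= a 0 i <= 1) -> std_simplex p -> 0 <= pairing p a <= 1.
Proof.
move=> a01 [p0 <-]; apply/andP; split.
  by apply: sumr_ge0 => i _; apply: mulr_ge0 => //; have /andP[] := a01 i.
by apply: ler_sum => i _; apply: ler_piMr => //; have /andP[] := a01 i.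
Qed.

Lemma swept_simplex_smooth k (a b : 'rV[R]_k.+1) :
  (forall i, 0 <= a 0 i <= 1) -> smooth_simplex (swept_simplex a b).
Proof.
move=> a01.
have cL : continuous (swept_param a b).
  by move=> p; apply: differentiable_continuous;
     apply: (@ex_diff _ _ _ _ _ _ _ (is_diff_swept_param a b p)).
exists (swept_param a b @^-1` box); split.
- by apply: open_comp => //; exact: box_open.
- by move=> p /(pairing_std_simplex a01)/segment_img; split.
- have [orbC orbS] := act_smooth act_torus atlas_c; split.
    by move=> p bp; apply: continuous_comp; [exact: cL | exact: orbC].
  move=> d ad l; have := orbS d ad l.
  apply: Ck_on_comp; last exact: is_diff_swept_param.
  by apply: open_setI_preimage => //; [exact: box_open | exact: dom_open].
Qed.

(** An affine triangle in the [(s, t)]-plane has constant edge vectors; the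
    first factor is their determinant, and the argument of [height^`()] is the
    [s]-coordinate of the point with barycentric coordinates
    [(1 - s - t, s, t)]. *)
Lemma integral_swept_simplex (a b : 'rV[R]_3) :
  (forall i, 0 <= a 0 i <= 1) ->
  integral_simplex omega (swept_simplex a b) =
  \int[lebesgue_measure]_(s in `[0, 1]) \int[lebesgue_measure]_(t in `[0, 1 - s])
    (((a 0 1 - a 0 0) * (b 0 2 - b 0 0) - (a 0 2 - a 0 0) * (b 0 1 - b 0 0)) *
     height^`()%classic ((1 - s - t) * a 0 0 + s * a 0 1 + t * a 0 2)).
Proof.
move=> a01; rewrite /integral_simplex.
apply: eq_Rintegral_itv => s; rewrite in_itv/= => /andP[s0 s1].
apply: eq_Rintegral_itv => t; rewrite in_itv/= => /andP[t0 t1].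
set p := _ + _ + _.
have pE (e : 'rV[R]_3) :
    pairing p e = (1 - s - t) * e 0 0 + s * e 0 1 + t * e 0 2.
  by rewrite /p !pairingDl !pairingZl !pairing_delta.
rewrite -pE height_derive1.
have cy : img c (y + pairing p a *: v).
  apply: segment_img; rewrite pE.
  have /andP[? ?] := a01 0; have /andP[? ?] := a01 1; have /andP[? ?] := a01 2.
  by apply/andP; split; nra.
have dom_chart := chart_at_dom (swept_simplex a b p).
have atlas_chart := chart_at_atlas (swept_simplex a b p).
set d := chart_at _ in dom_chart atlas_chart *.
have dO : differentiable (to d \o orbit_map) (swept_param a b p).
  exact: orbit_map_differentiable.
have dL := is_diff_swept_param a b p.
have D i : 'D_(delta_mx 0 i - delta_mx 0 0) (to d \o swept_simplex a b) p =
    'D_((b 0 i - b 0 0) *: A, (a 0 i - a 0 0) *: v)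
      (to d \o orbit_map) (swept_param a b p).
  rewrite -[to d \o _]/((to d \o orbit_map) \o swept_param a b).
  have dLp := @ex_diff _ _ _ _ _ _ _ dL.
  by rewrite (derive_comp _ dLp dO) (deriveE _ dLp) diff_val !pairingBl !pairing_delta.
by rewrite !D form_on_orbit_map.
Qed.

End swept_segment.

End moment_geometry.

(** * Chains, and functions modulo integers *)

(** The class of [g x] modulo integers is locally constant, so each of its
    level sets is open, and closed because its complement is a union of the
    others. *)
Lemma connected_locally_constant_mod_int (R : realType) (T : topologicalType)
    (g : T -> R) : connected [set: T] ->
  (forall x, \forall y \near x, g y - g x \is a Num.int) ->
  forall x y, g y - g x \is a Num.int.
Proof.
move=> cT g_loc x y; pose B := [set z | g z - g x \is a Num.int].
suff BT : B = [set: T] by have : [set: T] y by []; rewrite -BT.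
have congr_g u z : g z - g u \is a Num.int -> B z <-> B u.
  move=> zu; rewrite /B/= -(subrKA (g u)); split => [Bz|Bu]; last exact: rpredD.
  by rewrite -(addKr (g z - g u) (g u - g x)) rpredD// rpredN.
apply: cT; first by exists x; rewrite /B/= subrr.
- exists B; last by rewrite setTI.
  rewrite openE => z Bz; apply: filterS (g_loc z) => u /congr_g[_]; exact.
- exists B; last by rewrite setTI.
  rewrite -[B]setCK; apply: open_closedC; rewrite openE => z Bz.
  by apply: filterS (g_loc z) => u /congr_g[Bu _] /Bu.
Qed.

Section chains.
Context {R : realType}.

Definition vec k (s : seq R) : 'rV[R]_k := \row_j s`_j.

Lemma vec_itv01 k (s : seq R) (i : 'I_k) :
  all (fun z => 0 <= z <= 1) s -> 0 <= vec k s 0 i <= 1.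
Proof.
move=> s01; rewrite mxE; have [i_s|s_i] := ltnP i (size s).
  exact: (all_nthP 0 s01).
by rewrite nth_default// lexx ler01.
Qed.

(** Restricting an affine function to a face deletes its value at the
    opposite vertex. *)
Lemma pairing_face k (i : 'I_k.+2) (p : 'rV[R]_k.+1) (a : 'rV[R]_k.+2) :
  pairing (face i p) a = pairing p (col' i a).
Proof.
rewrite /pairing (bigD1_ord i)//= mxE unlift_none mul0r add0r.
by apply: eq_bigr => j _; rewrite !mxE liftK.
Qed.

Lemma col'_vec3 (x y z : R) (i : 'I_3) :
  col' i (vec 3 [:: x; y; z]) =
  vec 2 (if i == 0 then [:: y; z] else if i == 1 then [:: x; z] else [:: x; y]).
Proof.
apply/rowP => j; rewrite !mxE.
by case: i => [[|[|[|]]]]// ?; case: j => [[|[|]]].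
Qed.

Lemma pairing_vec2 (p : 'rV[R]_2) (x y : R) :
  pairing p (vec 2 [:: x; y]) = p 0 0 * x + p 0 1 * y.
Proof.
rewrite /pairing big_ord_recl big_ord1 !mxE/=.
by congr (_ + p 0 _ * _); exact: val_inj.
Qed.

Lemma std_simplex1 (p : 'rV[R]_2) : std_simplex p -> p 0 0 + p 0 1 = 1.
Proof.
move=> [_ <-]; rewrite big_ord_recl big_ord1.
by congr (_ + p 0 _); exact: val_inj.
Qed.

Context {n : nat} {M : manifold R n}.

Lemma coboundary1E (G : zmodType) (b : ('rV[R]_2 -> M) -> G) sigma :
  coboundary b sigma =
  b (sigma \o face 0) - b (sigma \o face 1) + b (sigma \o face 2).
Proof.
rewrite /coboundary 2!big_ord_recl big_ord1 addrA.
have -> : lift ord0 ord0 = 1 :> 'I_3 by exact: val_inj.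
have -> : lift ord0 (lift ord0 ord0) = 2 :> 'I_3 by exact: val_inj.
by rewrite /= expr0 expr1 sqrrN expr1n !mulr1z mulrN1z.
Qed.

Lemma smooth_simplex_cst k (x : M) : smooth_simplex (cst x : 'rV[R]_k.+1 -> M).
Proof.
exists [set: 'rV[R]_k.+1]; split => //; first exact: openT.
split=> [p _|d _ l]; first exact: cst_continuous.
exact: (@Ck_on_cst _ _ _ _ _ (to d x)).
Qed.

Lemma integral_simplex_cst (w : form_field M) (x : M) :
  integral_simplex w (cst x) = 0.
Proof.
have I0 (u : R) : \int[lebesgue_measure]_(t in `[0, u]) (0 : R) = 0.
  rewrite -[RHS](mul0r (fine (@lebesgue_measure R `[0, u]%classic))).
  by apply: Rintegral_cst; exact: measurable_itv.
rewrite /integral_simplex -[RHS](I0 1); apply: eq_Rintegral_itv => s _.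
rewrite -[RHS](I0 (1 - s)); apply: eq_Rintegral_itv => t _.
by rewrite /form_at (derive_cst (to _ x)) mul0mx mul0mx mxE.
Qed.

End chains.

(** * Holonomy around the orbits *)

Section holonomy.
Context {R : realType} {n r : nat} {M : manifold R n}.
Variables (omega : form_field M) (act : 'rV[R[i]]_r -> M -> M).
Hypothesis act_torus : torus_action act.
Hypothesis omega_alternating :
  forall c x u, atlas c -> dom c x -> form_at omega c x u u = 0.
Variable Phi : M -> 'rV[R]_r.
Hypothesis Phi_moment : moment_map omega act Phi.
Variable A : 'rV[R]_r.
Hypothesis A_lattice : torus_exp A = torus_one R r.

Definition orbit_loop (x : M) (p : 'rV[R]_2) : M :=
  act (torus_exp (p 0 1 *: A)) x.

Variables (a : ('rV[R]_3 -> M) -> int) (b : ('rV[R]_2 -> M) -> R).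
Hypothesis b_cochain : cochain b.
Hypothesis omega_integral : forall sigma, smooth_simplex sigma ->
  integral_simplex omega sigma - (a sigma)%:~R = coboundary b sigma.

(** When [b] is read as the holonomy of a connection with curvature [omega],
    this is the exponent by which the lift of the circle action generated by
    [A] fails to close up; it is well defined modulo integers. *)
Definition holonomy_defect (x : M) : R :=
  moment_component Phi A x - b (orbit_loop x).

(** The coboundary of [b] on the constant triangle is [b - b + b], and it is
    integral because that triangle has area zero. *)
Lemma cst_cochain_int x : b (cst x) \is a Num.int.
Proof.
have -> : b (cst x) = coboundary b (cst x).
  by rewrite coboundary1E -[cst x \o face 1]/(cst x \o face 0) subrr add0r.
rewrite -(omega_integral (smooth_simplex_cst 2 x)) integral_simplex_cst sub0r.
by rewrite rpredN intr_int.
Qed.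

(** The orbit loop of a fixed point is a constant simplex. *)
Lemma fixed_point_holonomy_defect x : fixed_point act x ->
  holonomy_defect x - moment_component Phi A x \is a Num.int.
Proof.
move=> fix_x; rewrite /holonomy_defect addrAC subrr sub0r rpredN.
rewrite (_ : orbit_loop x = cst x) ?cst_cochain_int//.
by apply/funext => p; apply: fix_x; exact: torus_expT.
Qed.

Section along_segment.
Variables (c : chart R M n) (y v : 'rV[R]_n).
Hypothesis atlas_c : atlas c.
Hypothesis segment_img : forall s, 0 <= s <= 1 -> img c (y + s *: v).

Let S := swept_simplex act A c y v.

Let swept_face k (e f : 'rV[R]_k.+2) i :
  S e f \o face i = S (col' i e) (col' i f).
Proof.
by apply/funext => p; rewrite /S /swept_simplex /swept_param/= !pairing_face.
Qed.

(** The boundaries of the two triangles share the diagonal of the square,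
    and the bottom edge equals the top edge since [exp A = 1]; in the
    difference only the loops at the two ends of the segment survive. *)
Lemma holonomy_defect_segment :
  holonomy_defect (from c (y + 1 *: v)) - holonomy_defect (from c (y + 0 *: v))
    \is a Num.int.
Proof.
(* In the (s, t)-square, [lower] has the vertices (0,0), (1,0), (1,1) and
   [upper] has (0,0), (0,1), (1,1). *)
pose lower := S (vec 3 [:: 0; 1; 1]) (vec 3 [:: 0; 0; 1]).
pose upper := S (vec 3 [:: 0; 0; 1]) (vec 3 [:: 0; 1; 1]).
have lower01 i : 0 <= vec 3 [:: 0; 1; 1 : R] 0 i <= 1.
  by apply: vec_itv01; rewrite /= !lexx !ler01.
have upper01 i : 0 <= vec 3 [:: 0; 0; 1 : R] 0 i <= 1.
  by apply: vec_itv01; rewrite /= !lexx !ler01.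
have lower_smooth : smooth_simplex lower.
  exact: (swept_simplex_smooth act_torus A atlas_c segment_img _ lower01).
have upper_smooth : smooth_simplex upper.
  exact: (swept_simplex_smooth act_torus A atlas_c segment_img _ upper01).
have integrals : integral_simplex omega lower - integral_simplex omega upper =
    moment_component Phi A (from c (y + 1 *: v)) -
    moment_component Phi A (from c (y + 0 *: v)).
  pose h := height Phi A c y v.
  have <- := @integral_square_of_triangles _ h
    (height_derivable Phi_moment atlas_c segment_img)
    (height_derive1_continuous Phi_moment atlas_c segment_img).
  rewrite /lower /upper /S.
  apply: (congr2 (fun u l : R => u - l)).
    rewrite [LHS](integral_swept_simplex act_torus omega_alternating Phi_moment
      A atlas_c segment_img _ lower01).
    apply: eq_Rintegral_itv => s _; apply: eq_Rintegral_itv => t _.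
    by rewrite !mxE/= -[RHS]mul1r; congr (_ * h^`()%classic _); ring.
  rewrite [LHS](integral_swept_simplex act_torus omega_alternating Phi_moment
    A atlas_c segment_img _ upper01).
  apply: eq_Rintegral_itv => s _; apply: eq_Rintegral_itv => t _.
  by rewrite !mxE/= -[RHS]mulN1r; congr (_ * h^`()%classic _); ring.
have edge (e f : 'rV[R]_2) (g : 'rV[R]_2 -> M) :
    (forall p, std_simplex p -> S e f p = g p) -> b (S e f) = b g.
  by move=> eg; exact: b_cochain.
have SE (x1 x2 t1 t2 : R) p : S (vec 2 [:: x1; x2]) (vec 2 [:: t1; t2]) p =
    act (torus_exp ((p 0 0 * t1 + p 0 1 * t2) *: A))
      (from c (y + (p 0 0 * x1 + p 0 1 * x2) *: v)).
  by rewrite /S /swept_simplex /swept_param /orbit_map/= !pairing_vec2.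
have right_edge : b (lower \o face 0) = b (orbit_loop (from c (y + 1 *: v))).
  rewrite /lower swept_face !col'_vec3; apply: edge => p /std_simplex1 p1.
  by rewrite SE !mulr1 mulr0 add0r p1.
have left_edge : b (upper \o face 2) = b (orbit_loop (from c (y + 0 *: v))).
  rewrite /upper swept_face !col'_vec3; apply: edge => p _.
  by rewrite SE !mulr1 !mulr0 !add0r.
have diagonal : b (lower \o face 1) = b (upper \o face 1).
  by rewrite /lower /upper !swept_face !col'_vec3.
have horizontal : b (lower \o face 2) = b (upper \o face 0).
  rewrite /lower /upper !swept_face !col'_vec3; apply: edge => p /std_simplex1 p1.
  rewrite !SE !mulr1 !mulr0 !add0r p1 scale0r scale1r A_lattice.
  by rewrite torus_exp0.
have := omega_integral lower_smooth; have := omega_integral upper_smooth.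
rewrite !coboundary1E right_edge left_edge diagonal horizontal => up low.
rewrite /holonomy_defect.
suff -> : moment_component Phi A (from c (y + 1 *: v)) -
    b (orbit_loop (from c (y + 1 *: v))) -
    (moment_component Phi A (from c (y + 0 *: v)) -
    b (orbit_loop (from c (y + 0 *: v)))) = (a lower)%:~R - (a upper)%:~R :> R.
  by rewrite rpredB// intr_int.
move: integrals up low.
set bd := b (upper \o face 1); set bh := b (upper \o face 0).
set br := b _; set bl := b _; set Il := integral_simplex _ _.
set Iu := integral_simplex _ _; set al := _%:~R; set au := _%:~R.
set m1 := moment_component _ _ _; set m0 := moment_component _ _ _.
lra.
Qed.

End along_segment.

(** Balls in a chart are convex, so nearby points are joined by a segment. *)
Lemma holonomy_defect_locally_constant x :
  \forall z \near x, holonomy_defect z - holonomy_defect x \is a Num.int.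
Proof.
have xc := chart_at_dom x; have ac := chart_at_atlas x.
set c := chart_at x in xc ac.
have /nbhs_ballP[e /= e0 ball_img] : nbhs (to c x) (img c).
  by apply: open_nbhs_nbhs; split; [exact: img_open | exists x].
have near_dom : \forall z \near x, dom c z.
  by apply: open_nbhs_nbhs; split; [exact: dom_open|].
have near_ball : \forall z \near x, ball (to c x) e (to c z).
  exact: (to_continuous xc) (nbhsx_ballx _ _ e0).
apply: filterS2 near_dom near_ball => z zc.
rewrite -ball_normE/= => xz.
pose v := to c z - to c x.
have seg s : 0 <= s <= 1 -> img c (to c x + s *: v).
  move=> /andP[s0 s1]; apply: ball_img; rewrite -ball_normE/=.
  rewrite opprD addNKr normrN normrZ ger0_norm//.
  by apply: le_lt_trans xz; rewrite distrC ler_piMl.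
have := holonomy_defect_segment ac seg.
have end0 : to c x + 0 *: v = to c x by rewrite scale0r addr0.
have end1 : to c x + 1 *: v = to c z by rewrite scale1r addrC subrK.
by rewrite end0 end1 !toK.
Qed.

End holonomy.

(** * Normalizing the moment map *)

Section shifting_moment_maps.
Context {R : realType}.

Lemma derive_subr_cst (V W : normedModType R) (f : V -> W) (k : W) x v :
  'D_v (fun y => f y - k) x = 'D_v f x.
Proof.
rewrite /derive; suff -> : (fun h : R => h^-1 *: (f (h *: v + x) - k - (f x - k))) =
  (fun h => h^-1 *: (f (h *: v + x) - f x)) by [].
by apply/funext => h; rewrite opprB addrA subrK.
Qed.

Lemma Ck_on_subr_cst (V W : normedModType R) l (U : set V) (f : V -> W) (k : W) :
  Ck_on l U f -> Ck_on l U (fun y => f y - k).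
Proof.
case: l => [|l] /=.
  by move=> cf x Ux; apply: continuousB; [exact: cf | exact: cst_continuous].
move=> [df Df]; split; last by move=> v; rewrite (funext (derive_subr_cst f k ^~ v)).
by move=> x Ux; apply: differentiableB; [exact: df | exact: differentiable_cst].
Qed.

Lemma moment_map_subr_cst (n r : nat) (M : manifold R n) (omega : form_field M)
    (act : 'rV[R[i]]_r -> M -> M) (Phi : M -> 'rV[R]_r) (k : 'rV[R]_r) :
  moment_map omega act Phi -> moment_map omega act (fun x => Phi x - k).
Proof.
move=> [Phi_smooth Phi_eq]; split.
  by move=> c ac l; exact: Ck_on_subr_cst (Phi_smooth c ac l).
move=> A c x v ac cx; rewrite Phi_eq//; congr (- _).
under [X in _ = 'D_v X _]funext do rewrite pairingBl.
by rewrite derive_subr_cst.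
Qed.

End shifting_moment_maps.

Theorem corollary12 (R : realType) (n r : nat) (M : manifold R n)
    (omega : form_field M) (act : 'rV[R[i]]_r -> M -> M)
    (M_compact : compact [set: M]) (M_connected : connected [set: M])
    (omega_symplectic : symplectic_form omega)
    (omega_quantizable : integral_class omega)
    (act_hamiltonian : hamiltonian_action omega act) :
  exists Phi : M -> 'rV[R]_r,
    moment_map omega act Phi /\
    forall xi : 'rV[R]_r, vertex act Phi xi -> integer_lattice_point xi.
Proof.
have [act_torus _ [Phi Phi_moment]] := act_hamiltonian.
have omega_alt := form_alternating omega_symplectic.
have [a [b [_ b_cochain _ omega_integral]]] := omega_quantizable.
have [[p p_fixed]|no_fixed] := pselect (exists p, fixed_point act p); last first.
  by exists Phi; split=> // xi [q q_fixed _]; case: no_fixed; exists q.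
exists (fun x => Phi x - Phi p); split; first exact: moment_map_subr_cst.
move=> _ [q q_fixed ->] A A_lattice; rewrite pairingBl.
have const := holonomy_defect_locally_constant act_torus omega_alt Phi_moment
  A_lattice b_cochain omega_integral.
have pq := connected_locally_constant_mod_int M_connected const p q.
have defect x (x_fixed : fixed_point act x) :=
  fixed_point_holonomy_defect Phi A omega_integral x_fixed.
rewrite -/(moment_component Phi A q) -/(moment_component Phi A p).
set mq := moment_component Phi A q; set mp := moment_component Phi A p.
(* The defects at [p] and [q] agree modulo integers, and each equals the moment
   value there modulo integers. *)
have -> : mq - mp = holonomy_defect act Phi A b q - holonomy_defect act Phi A b p
    - (holonomy_defect act Phi A b q - mq) + (holonomy_defect act Phi A b p - mp).
  by ring.
by apply: rpredD (rpredB pq (defect q q_fixed)) (defect p p_fixed).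
Qed.
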